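(* (Reverse) Let $a\ge 0$, $t\ge a$ and $0<\alpha<1$. Also, let $f$ be a continuous function such that ${}_{a}^{\rho}\mathcal{I}_{\gamma,\beta,\alpha}^{\delta,p,q}f(t)$ exists. Then $${}_{i}^{\rho}\mathcal{V}_{\gamma,\beta,\alpha}^{\delta,p,q}\Big({}_{a}^{\rho}\mathcal{I}_{\gamma,\beta,\alpha}^{\delta,p,q}f(t)\Big)=f(t),$$ with $\gamma,\beta,\rho,\delta\in\mathbb{C}$ and $p,q>0$ such that $\mathrm{Re}(\gamma)>0$, $\mathrm{Re}(\beta)>0$, $\mathrm{Re}(\rho)>0$, $\mathrm{Re}(\delta)>0$ and $\mathrm{Re}(\gamma)+p\ge q$.
   Context: Here $(\rho)_{s}=\Gamma(\rho+s)/\Gamma(\rho)$ and $(\delta)_{s}=\Gamma(\delta+s)/\Gamma(\delta)$ are (generalized) Pochhammer symbols. The truncated function, with the index $i$ being the upper limit of summation, is $${}_{i}H_{\gamma,\beta,p}^{\rho,\delta,q}(z):=\Gamma(\beta)\sum_{k=0}^{i}\frac{(\rho)_{qk}}{(\delta)_{pk}}\frac{z^k}{\Gamma(\gamma k+\beta)}.$$ The truncated $\mathcal{V}$-fractional derivative of order $\alpha$, $0<\alpha<1$, of a function $h$ is defined, for $t>0$, by $${}_{i}^{\rho}\mathcal{V}_{\gamma,\beta,\alpha}^{\delta,p,q}h(t):=\lim_{\epsilon\to 0}\frac{h\big(t\,{}_{i}H_{\gamma,\beta,p}^{\rho,\delta,q}(\epsilon t^{-\alpha})\big)-h(t)}{\epsilon}.$$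 For $a\ge 0$, $t\ge a$, a function $f$ defined on $(a,t]$ and $0<\alpha<1$, the $\mathcal{V}$-fractional integral of $f$ of order $\alpha$ is $${}_{a}^{\rho}\mathcal{I}_{\gamma,\beta,\alpha}^{\delta,p,q}f(t):=\frac{\Gamma(\gamma+\beta)(\delta)_p}{\Gamma(\beta)(\rho)_q}\int_a^t\frac{f(x)}{x^{1-\alpha}}\,dx.$$ In the claim the derivative is applied to this integral as a function of $t$.
   Formalization: The upper limit i is taken ≥ 1 (for i = 0 the derivative is 0 and the claim fails for f = 1); as t·H(εt^{-α}) may be non-real for complex parameters, ε→0 runs over nonzero complex ε making it a real point of the integral's domain, and 0 is proved to be a limit point of these. *)

(* Defs.v *)
From Stdlib Require Import Reals.
From Coquelicot Require Import Coquelicot.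

Open Scope R_scope.

(* [x ^ z] for real [x > 0] and complex [z]. *)
Definition Rpow_C (x : R) (z : C) : C :=
  (exp (Re z * ln x) * cos (Im z * ln x), exp (Re z * ln x) * sin (Im z * ln x)).

(* Euler's integral; only meaningful for [0 < Re z], which covers every use
   below. *)
Definition CGamma (z : C) : C :=
  RInt_gen (V := C_R_CompleteNormedModule)
    (fun x : R => (Rpow_C x (z - 1) * RtoC (exp (- x)))%C)
    (at_right 0) (Rbar_locally p_infty).

Definition poch (z : C) (s : R) : C := (CGamma (z + RtoC s) / CGamma z)%C.

Definition truncH (i : nat) (gamma beta rho delta : C) (p q : R) (z : C) : C :=
  (CGamma beta *
   sum_n (fun k : nat =>
     poch rho (q * INR k) / poch delta (p * INR k)
     * (z ^ k / CGamma (gamma * RtoC (INR k) + beta))) i)%C.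

(* The point [t * H (eps * t ^ (- alpha))] at which the differentiated function
   is evaluated. *)
Definition Varg (i : nat) (gamma beta rho delta : C) (p q alpha t : R)
    (eps : C) : C :=
  (RtoC t * truncH i gamma beta rho delta p q
              (eps * RtoC (Rpower t (- alpha))))%C.

(* Since the parameters are complex, [Varg] is complex-valued in general, while
   the differentiated function [h] lives on a set [D] of real numbers.  The
   increments are therefore complex numbers, and the limit is taken over those
   nonzero increments at which [h (Varg eps)] makes sense. *)
Definition Vadm (i : nat) (gamma beta rho delta : C) (p q alpha : R)
    (D : R -> Prop) (t : R) (eps : C) : Prop :=
  let y := Varg i gamma beta rho delta p q alpha t eps in
  eps <> RtoC 0 /\ Im y = 0 /\ D (Re y).

Definition Vquot (i : nat) (gamma beta rho delta : C) (p q alpha : R)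
    (h : R -> C) (t : R) (eps : C) : C :=
  ((h (Re (Varg i gamma beta rho delta p q alpha t eps)) - h t) / eps)%C.

(* [h], defined on [D], has truncated V-fractional derivative [l] at [t].  The
   [ProperFilter] clause says that 0 is a limit point of the admissible
   increments, so that the limit is not vacuous and determines [l]. *)
Definition is_Vderive (i : nat) (gamma beta rho delta : C) (p q alpha : R)
    (D : R -> Prop) (h : R -> C) (t : R) (l : C) : Prop :=
  let F := within (Vadm i gamma beta rho delta p q alpha D t)
                  (locally (RtoC 0)) in
  ProperFilter F /\
  filterlim (Vquot i gamma beta rho delta p q alpha h t) F (locally l).

(* When real increments are admissible (e.g. real parameters and [t] interior
   to [D]), the value is the ordinary limit over real increments. *)
Lemma is_Vderive_real_increments (i : nat) (gamma beta rho delta : C)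
    (p q alpha : R) (D : R -> Prop) (h : R -> C) (t : R) (l : C) :
  locally' 0 (fun e : R =>
    Vadm i gamma beta rho delta p q alpha D t (RtoC e)) ->
  is_Vderive i gamma beta rho delta p q alpha D h t l ->
  filterlim (fun e : R =>
    Vquot i gamma beta rho delta p q alpha h t (RtoC e))
    (locally' 0) (locally l).
Proof.
  intros Hadm [_ Hlim] P HP.
  destruct (Hlim P HP) as [d Hd].
  destruct Hadm as [d' Hd'].
  exists (mkposreal _ (Rmin_stable_in_posreal d d')); simpl.
  intros e He Hne.
  apply Hd.
  - split; simpl.
    + apply (ball_le (0 : R) (Rmin d d')); [apply Rmin_l | exact He].
    + apply (ball_center (0 : R) d).
  - apply Hd'; [| exact Hne].
    apply (ball_le (0 : R) (Rmin d d')); [apply Rmin_r | exact He].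
Qed.

Definition Vintegrand (alpha : R) (f : R -> C) (x : R) : C :=
  (f x / RtoC (Rpower x (1 - alpha)))%C.

(* [f] is only defined on (a, t], so the integral is improper at [a]. *)
Definition ex_Vint (alpha a : R) (f : R -> C) (t : R) : Prop :=
  ex_RInt_gen (V := C_R_NormedModule) (Vintegrand alpha f)
    (at_right a) (at_point t).

Definition Vint (gamma beta rho delta : C) (p q alpha a : R) (f : R -> C)
    (t : R) : C :=
  (CGamma (gamma + beta) * poch delta p / (CGamma beta * poch rho q)
   * RInt_gen (V := C_R_CompleteNormedModule) (Vintegrand alpha f)
       (at_right a) (at_point t))%C.

(* Main.v *)
Require Import Defs.
From Stdlib Require Import Reals Lra Lia.
From Coquelicot Require Import Coquelicot.

Open Scope R_scope.

(** The point [Varg eps] is a polynomial [t + A eps + S(eps)] with [S] of order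
    at least 2, so the chain rule gives the value [h'(t) A], and [A] is exactly
    what cancels the factor [K t^(alpha - 1)] in [h'(t) = K t^(alpha - 1) f(t)].

    Two points need an argument. First, [A <> 0] and the cancellation require
    that Gamma has no zero in the right half plane. By [Gamma(z+1) = z Gamma(z)]
    it suffices to treat large real parts. With [z = x + i y],
    [Re (x^(-i y) Gamma(z))] is the integral of
    [s^(x-1) e^(-s) cos(y ln(s/x))], and
    [cos v >= 1 - v^2/2], [(ln u)^2 <= u - 2 + 1/u] bound it below by
    [Gamma(x) (1 - y^2 / (2 (x - 1)))].
    Second, since the parameters are complex, real increments [eps] need not
    give real points; admissible increments accumulate at 0 because
    [A eps + S(eps) = w] can be solved for small real [w], by contraction. *)

(** * Gamma has no zero in the right half plane *)

(** Over a proper interval the integral is [F b - F a], and this difference converges along the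
    product filter. Only positive end points are tested, so integrands singular at 0 are allowed. *)
Lemma is_RInt_gen_primitive {V : NormedModule R_AbsRing} (f F : R -> V)
    (Fa Fb : (R -> Prop) -> Prop) (FFa : Filter Fa) (FFb : Filter Fb) (la lb : V) :
  Fa (fun x => 0 < x) -> Fb (fun x => 0 < x) ->
  (forall a b, 0 < a -> 0 < b -> is_RInt f a b (minus (F b) (F a))) ->
  filterlim F Fa (locally la) -> filterlim F Fb (locally lb) ->
  is_RInt_gen f Fa Fb (minus lb la).
Proof.
  intros Ha Hb HF Hla Hlb P HP.
  assert (Hm : filterlim (fun ab : R * R => minus (F (snd ab)) (F (fst ab)))
                 (filter_prod Fa Fb) (locally (minus lb la))).
  { unfold minus.
    apply (filterlim_comp_2 (G := locally lb) (H := locally (opp la))).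
    - apply filterlim_comp with (2 := Hlb), filterlim_snd.
    - apply filterlim_comp with (G := locally la).
      + apply filterlim_comp with (2 := Hla), filterlim_fst.
      + apply filterlim_opp.
    - apply filterlim_plus. }
  specialize (Hm P HP). unfold filtermap in Hm. unfold filtermapi.
  assert (Hp : filter_prod Fa Fb (fun ab : R * R => 0 < fst ab /\ 0 < snd ab))
    by (apply Filter_prod with (1 := Ha) (2 := Hb); now split).
  generalize (filter_and _ _ Hp Hm). clear Hp Hm. apply filter_imp.
  intros [a b] [[H1 H2] H3]; simpl in *.
  eexists; split; [apply HF; assumption | exact H3].
Qed.

Lemma ex_RInt_pos (f : R -> R) (a b : R) :
  (forall x, 0 < x -> continuous f x) -> 0 < a -> 0 < b -> ex_RInt f a b.
Proof.
  intros Hf Ha Hb. apply (ex_RInt_continuous (V := R_CompleteNormedModule)).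
  intros z Hz. apply Hf. pose proof (Rmin_glb_lt _ _ _ Ha Hb). lra.
Qed.

(** Cauchy criterion: increments of the integral of [f] are bounded by increments of [G], which are
    Cauchy because [G] converges. *)
Lemma primitive_dominated_lim (f g G : R -> R)
    (F : (R -> Prop) -> Prop) (FF : ProperFilter F) (l : R) :
  (forall x, 0 < x -> continuous f x) -> (forall x, 0 < x -> continuous g x) ->
  (forall x, 0 < x -> Rabs (f x) <= g x) ->
  (forall x, 0 < x -> is_derive G x (g x)) ->
  F (fun x => 0 < x) -> filterlim G F (locally l) ->
  exists l', filterlim (fun x => RInt f 1 x) F (locally (l' : R)).
Proof.
  intros Hf Hg Hfg HG HF Hl.
  assert (key : forall u v, 0 < u -> u <= v ->
     Rabs (RInt f 1 v - RInt f 1 u) <= G v - G u).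
  { intros u v Hu Huv. assert (Hv : 0 < v) by lra.
    replace (RInt f 1 v - RInt f 1 u) with (RInt f u v).
    2:{ pose proof (RInt_Chasles f 1 u v (ex_RInt_pos f 1 u Hf Rlt_0_1 Hu)
          (ex_RInt_pos f u v Hf Hu Hv)) as E. unfold plus in E; simpl in E. lra. }
    apply (norm_RInt_le (V := R_NormedModule) f g u v); try assumption.
    - intros x Hx. apply Hfg. lra.
    - apply (RInt_correct (V := R_CompleteNormedModule)). now apply ex_RInt_pos.
    - apply (is_RInt_derive (V := R_CompleteNormedModule) G g); intros x Hx;
        rewrite Rmin_left in Hx by lra; [apply HG | apply Hg]; lra. }
  apply (proj1 (filterlim_locally_cauchy (U := R_CompleteNormedModule)
     (fun x => RInt f 1 x))).
  intros eps.
  destruct (proj2 (filterlim_locally_cauchy (U := R_CompleteNormedModule) (F := F) G)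
     (ex_intro _ l Hl) eps) as [P [HP HPc]].
  exists (fun x => P x /\ 0 < x). split; [now apply filter_and|].
  intros u v [Hu Hu0] [Hv Hv0]. specialize (HPc u v Hu Hv).
  change (Rabs (RInt f 1 v - RInt f 1 u) < eps). change (Rabs (G v - G u) < eps) in HPc.
  destruct (Rle_dec u v) as [L|L].
  - eapply Rle_lt_trans; [|exact HPc]. eapply Rle_trans; [apply (key u v Hu0 L)|apply Rle_abs].
  - assert (L' : v <= u) by lra.
    rewrite Rabs_minus_sym. rewrite Rabs_minus_sym in HPc.
    eapply Rle_lt_trans; [|exact HPc]. eapply Rle_trans; [apply (key v u Hv0 L')|apply Rle_abs].
Qed.

Lemma at_right_pos : at_right 0 (fun x => 0 < x).
Proof. exists (mkposreal 1 Rlt_0_1). now intros. Qed.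

Lemma at_right_0_lt_1 : at_right 0 (fun x => 0 < x < 1).
Proof.
  exists (mkposreal 1 Rlt_0_1). intros y Hy Hy0.
  change (Rabs (y - 0) < 1) in Hy. apply Rabs_def2 in Hy. lra.
Qed.

Lemma p_infty_pos : Rbar_locally p_infty (fun x => 0 < x).
Proof. exists 0. now intros. Qed.

Notation is_RInt_pos f l := (is_RInt_gen f (at_right 0) (Rbar_locally p_infty) l).

(** Comparison test at both improper ends at once, with an explicit primitive [G] of the majorant;
    the integral is split at 1. *)
Lemma ex_RInt_pos_dominated (f g G : R -> R) (l0 l1 : R) :
  (forall x, 0 < x -> continuous f x) -> (forall x, 0 < x -> continuous g x) ->
  (forall x, 0 < x -> Rabs (f x) <= g x) ->
  (forall x, 0 < x -> is_derive G x (g x)) ->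
  filterlim G (at_right 0) (locally l0) ->
  filterlim G (Rbar_locally p_infty) (locally l1) ->
  exists l, is_RInt_pos f l.
Proof.
  intros Hf Hg Hfg HG H0 H1.
  destruct (primitive_dominated_lim f g G (at_right 0) _ l0 Hf Hg Hfg HG
    at_right_pos H0) as [k0 K0].
  destruct (primitive_dominated_lim f g G (Rbar_locally p_infty) _ l1 Hf Hg Hfg HG
    p_infty_pos H1) as [k1 K1].
  exists (minus k1 k0).
  apply is_RInt_gen_primitive with (F := fun x => RInt f 1 x); try assumption.
  - apply filter_filter.
  - apply filter_filter.
  - apply at_right_pos.
  - apply p_infty_pos.
  - intros a b Ha Hb.
    refine (eq_ind _ (fun l : R => is_RInt f a b l)
      (RInt_correct (V := R_CompleteNormedModule) f a b (ex_RInt_pos f a b Hf Ha Hb)) _ _).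
    pose proof (RInt_Chasles f 1 a b (ex_RInt_pos f 1 a Hf Rlt_0_1 Ha)
        (ex_RInt_pos f a b Hf Ha Hb)) as E.
    unfold minus, plus, opp in *; simpl in *. lra.
Qed.

(** * Convergence and integration by parts for integrals against s^(x-1) e^(-s) *)

Definition gamma_weight (x s : R) : R := exp ((x - 1) * ln s) * exp (- s).

Lemma gamma_weight_gt_0 x s : 0 < gamma_weight x s.
Proof. apply Rmult_lt_0_compat; apply exp_pos. Qed.

Lemma continuous_of_ex_derive (f : R -> R) (x : R) : ex_derive f x -> continuous f x.
Proof. apply (ex_derive_continuous (K := R_AbsRing) (V := R_NormedModule)). Qed.

Lemma continuous_gamma_weight x s : 0 < s -> continuous (gamma_weight x) s.
Proof.
  intros Hs. apply continuous_of_ex_derive. unfold gamma_weight. auto_derive. lra.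
Qed.

Lemma exp_ln_over x s : 0 < s -> exp (x * ln s) = s * exp ((x - 1) * ln s).
Proof.
  intros Hs. replace (x * ln s) with (ln s + (x - 1) * ln s) by ring.
  rewrite exp_plus, exp_ln; auto.
Qed.

Lemma exp_le (x y : R) : x <= y -> exp x <= exp y.
Proof. intros [H| ->]; [left; now apply exp_increasing | right; reflexivity]. Qed.

Lemma ln_le_sub_1 u : 0 < u -> ln u <= u - 1.
Proof.
  intros Hu. pose proof (exp_ineq1_le (ln u)) as H. rewrite exp_ln in H by assumption. lra.
Qed.

(** Applying [ln v <= v - 1] at v = s/(2x) gives s^x <= (2x)^x e^(s/2), hence (1 + s^x)^2 <= (1 +
    (2x)^x)^2 e^s. The bound replaces e^(-s) by K/(1 + s^x)^2, which has an elementary primitive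
    once multiplied by s^(x-1). *)
Lemma one_plus_power_sqr_le (x : R) : 0 < x ->
  exists K, 0 < K /\ forall s, 0 < s -> (1 + exp (x * ln s)) ^ 2 * exp (- s) <= K.
Proof.
  intros Hx. set (A := exp (x * ln (2 * x))).
  exists ((1 + A) ^ 2). assert (HA : 0 < A) by apply exp_pos.
  split; [nra|]. intros s Hs.
  assert (H1 : exp (x * ln s) <= A * exp (s / 2)).
  { unfold A. rewrite <- exp_plus. apply exp_le.
    assert (Hd : 0 < s / (2 * x)) by (apply Rdiv_lt_0_compat; lra).
    pose proof (ln_le_sub_1 (s / (2 * x)) Hd) as H.
    rewrite ln_div in H by lra.
    apply Rmult_le_compat_l with (r := x) in H; [|lra].
    replace (x * (s / (2 * x) - 1)) with (s / 2 - x) in H by (field; lra). lra. }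
  assert (H2 : 1 <= exp (s / 2)) by (rewrite <- exp_0; apply exp_le; lra).
  assert (H3 : exp (- s) = / (exp (s / 2)) ^ 2).
  { rewrite exp_Ropp. f_equal. simpl. rewrite Rmult_1_r, <- exp_plus. f_equal. lra. }
  rewrite H3. pose proof (exp_pos (x * ln s)) as H4.
  assert (0 < exp (s / 2) ^ 2) by nra.
  apply Rmult_le_reg_r with (exp (s / 2) ^ 2); [assumption|].
  rewrite Rmult_assoc, Rinv_l, Rmult_1_r by lra.
  replace ((1 + A) ^ 2 * exp (s / 2) ^ 2) with (((1 + A) * exp (s / 2)) ^ 2) by ring.
  apply pow_incr. split; nra.
Qed.

Lemma filterlim_mult_ln_0 (x : R) : 0 < x ->
  filterlim (fun s => x * ln s) (at_right 0) (Rbar_locally m_infty).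
Proof.
  intros Hx. apply filterlim_comp with (1 := is_lim_ln_0).
  replace m_infty with (Rbar_mult x m_infty) at 2.
  - apply filterlim_Rbar_mult_l.
  - simpl. destruct Rle_dec; [destruct Rle_lt_or_eq_dec; [reflexivity|lra] | lra].
Qed.

Lemma filterlim_mult_ln_p (x : R) : 0 < x ->
  filterlim (fun s => x * ln s) (Rbar_locally p_infty) (Rbar_locally p_infty).
Proof.
  intros Hx. apply filterlim_comp with (1 := is_lim_ln_p).
  replace p_infty with (Rbar_mult x p_infty) at 2.
  - apply filterlim_Rbar_mult_l.
  - simpl. destruct Rle_dec; [destruct Rle_lt_or_eq_dec; [reflexivity|lra] | lra].
Qed.

Lemma filterlim_power_0 (x : R) : 0 < x ->
  filterlim (fun s => exp (x * ln s)) (at_right 0) (locally 0).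
Proof.
  intros Hx. apply filterlim_comp with (2 := is_lim_exp_m). now apply filterlim_mult_ln_0.
Qed.

Lemma filterlim_inv_power_p (x : R) : 0 < x ->
  filterlim (fun s => / exp (x * ln s)) (Rbar_locally p_infty) (locally 0).
Proof.
  intros Hx. apply filterlim_ext with (fun s => exp (- (x * ln s))).
  { intros s. apply exp_Ropp. }
  apply filterlim_comp with (2 := is_lim_exp_m).
  apply filterlim_comp with (1 := filterlim_mult_ln_p x Hx).
  apply (filterlim_Rbar_opp p_infty).
Qed.

Lemma filterlim_0_dominated (f g : R -> R) (F : (R -> Prop) -> Prop) (FF : Filter F) :
  F (fun x => Rabs (f x) <= g x) -> filterlim g F (locally 0) -> filterlim f F (locally 0).
Proof.
  intros Hfg Hg. apply filterlim_locally. intros eps.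
  generalize (filter_and _ _ Hfg (proj1 (filterlim_locally g 0) Hg eps)).
  apply filter_imp. intros x [H1 H2].
  change (Rabs (f x - 0) < eps). change (Rabs (g x - 0) < eps) in H2.
  rewrite Rminus_0_r in *. pose proof (Rle_abs (g x)). lra.
Qed.

Lemma filterlim_scal_0 (k : R) (g : R -> R) (F : (R -> Prop) -> Prop) :
  filterlim g F (locally 0) -> filterlim (fun x => k * g x) F (locally 0).
Proof.
  intros Hg. apply filterlim_comp with (1 := Hg).
  pose proof (filterlim_scal_r (K := R_AbsRing) (V := R_NormedModule) k 0) as H.
  unfold scal in H; simpl in H; unfold mult in H; simpl in H.
  now rewrite Rmult_0_r in H.
Qed.

(** The majorant K s^(x-1)/(1 + s^x)^2 is the derivative of -(K/x)/(1 + s^x), which has finite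
    limits at 0 and at infinity for every x > 0. *)
Lemma ex_RInt_gamma_weight (x : R) (phi : R -> R) : 0 < x ->
  (forall s, 0 < s -> continuous phi s) -> (forall s, Rabs (phi s) <= 1) ->
  exists l, is_RInt_pos (fun s => gamma_weight x s * phi s) l.
Proof.
  intros Hx Hc Hb. destruct (one_plus_power_sqr_le x Hx) as [K [HK HKs]].
  apply (ex_RInt_pos_dominated _
    (fun s => K / x * (x * exp ((x - 1) * ln s) / (1 + exp (x * ln s)) ^ 2))
    (fun s => K / x * (- / (1 + exp (x * ln s)))) (K / x * (- / (1 + 0))) 0).
  - intros s Hs. apply (continuous_mult (K := R_AbsRing)).
    + now apply continuous_gamma_weight.
    + now apply Hc.
  - intros s Hs. apply continuous_of_ex_derive.
    assert (0 < exp (x * ln s)) by apply exp_pos. auto_derive.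
    repeat split; try lra. nra.
  - intros s Hs. rewrite Rabs_mult, (Rabs_pos_eq (gamma_weight x s))
      by apply Rlt_le, gamma_weight_gt_0.
    apply Rle_trans with (gamma_weight x s * 1).
    { apply Rmult_le_compat_l; [apply Rlt_le, gamma_weight_gt_0 | apply Hb]. }
    unfold gamma_weight. rewrite Rmult_1_r.
    replace (K / x * (x * exp ((x - 1) * ln s) / (1 + exp (x * ln s)) ^ 2))
      with (exp ((x - 1) * ln s) * (K / (1 + exp (x * ln s)) ^ 2))
      by (field; split; [pose proof (exp_pos (x * ln s)); lra | lra]).
    apply Rmult_le_compat_l; [apply Rlt_le, exp_pos|].
    specialize (HKs s Hs). pose proof (exp_pos (x * ln s)).
    apply Rle_div_r; [|lra]. nra.
  - intros s Hs. pose proof (exp_pos (x * ln s)). auto_derive; [split; lra|].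
    rewrite (exp_ln_over x s Hs) at 1. field. repeat split; lra.
  - apply (filterlim_comp _ _ _ (fun s => exp (x * ln s))
      (fun u => K / x * (- / (1 + u))) _ _ _ (filterlim_power_0 x Hx)).
    change (continuous (fun u => K / x * (- / (1 + u))) 0).
    apply continuous_of_ex_derive. auto_derive. lra.
  - apply filterlim_scal_0.
    apply filterlim_0_dominated with (g := fun s => / exp (x * ln s)).
    + apply filter_filter.
    + apply filter_forall. intros s. pose proof (exp_pos (x * ln s)).
      rewrite Rabs_Ropp, Rabs_pos_eq.
      * apply Rinv_le_contravar; lra.
      * apply Rlt_le, Rinv_0_lt_compat; lra.
    + now apply filterlim_inv_power_p.
Qed.

(** Integration by parts: the integrand is the derivative of s^x e^(-s) phi(s), which vanishes at
    both ends. Taking phi = 1, cos(y ln s) and sin(y ln s) yields the functional equations of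
    Gamma. *)
Lemma is_RInt_gamma_boundary (x : R) (phi dphi : R -> R) : 0 < x ->
  (forall s, 0 < s -> is_derive phi s (dphi s)) ->
  (forall s, 0 < s -> continuous dphi s) -> (forall s, Rabs (phi s) <= 1) ->
  is_RInt_pos (fun s => gamma_weight x s * (x * phi s + s * dphi s)
                        - gamma_weight (x + 1) s * phi s) 0.
Proof.
  intros Hx Hd Hdc Hb.
  pose proof (fun s Hs => continuous_of_ex_derive phi s (ex_intro _ _ (Hd s Hs))) as Hc.
  assert (W : forall s, 0 < s -> gamma_weight (x + 1) s = s * gamma_weight x s).
  { intros s Hs. unfold gamma_weight. rewrite (exp_ln_over _ s Hs).
    replace (x + 1 - 1 - 1) with (x - 1) by ring. ring. }
  refine (eq_ind (minus (0 : R) (0 : R)) (fun l : R => is_RInt_pos _ l) _ 0 (minus_eq_zero _)).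
  apply is_RInt_gen_primitive with (F := fun s => gamma_weight (x + 1) s * phi s).
  - apply filter_filter.
  - apply filter_filter.
  - apply at_right_pos.
  - apply p_infty_pos.
  - intros a b Ha Hb'.
    apply (is_RInt_derive (V := R_CompleteNormedModule)
      (fun s => gamma_weight (x + 1) s * phi s)); intros s Hs;
      assert (Hs0 : 0 < s) by (pose proof (Rmin_glb_lt _ _ _ Ha Hb'); lra).
    + replace (gamma_weight x s * (x * phi s + s * dphi s) - gamma_weight (x + 1) s * phi s)
        with (plus (mult (x * gamma_weight x s - gamma_weight (x + 1) s) (phi s))
                   (mult (gamma_weight (x + 1) s) (dphi s)))
        by (rewrite (W s Hs0); unfold plus, mult; simpl; ring).
      apply (is_derive_mult (gamma_weight (x + 1)) phi); [|now apply Hd|].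
      * unfold gamma_weight. auto_derive; [lra|].
        replace (x + 1 - 1) with x by ring. rewrite (exp_ln_over x s Hs0). field. lra.
      * intros n m. apply Rmult_comm.
    + apply (continuous_minus (V := R_NormedModule)).
      * apply (continuous_mult (K := R_AbsRing)); [now apply continuous_gamma_weight|].
        apply (continuous_plus (V := R_NormedModule)).
        -- apply (continuous_scal_r (V := R_NormedModule)). now apply Hc.
        -- apply (continuous_mult (K := R_AbsRing)); [apply continuous_id|now apply Hdc].
      * apply (continuous_mult (K := R_AbsRing)); [now apply continuous_gamma_weight|now apply Hc].
  (* Near 0 the boundary term is at most s^x. *)
  - apply filterlim_0_dominated with (g := fun s => exp (x * ln s)).
    + apply filter_filter.
    + generalize at_right_pos. apply filter_imp. intros s Hs.
      unfold gamma_weight. replace (x + 1 - 1) with x by ring.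
      rewrite !Rabs_mult, !(Rabs_pos_eq (exp _)) by apply Rlt_le, exp_pos.
      assert (exp (- s) <= 1) by (rewrite <- exp_0; apply exp_le; lra).
      pose proof (exp_pos (x * ln s)). pose proof (exp_pos (- s)).
      specialize (Hb s). pose proof (Rabs_pos (phi s)).
      rewrite Rmult_assoc. rewrite <- (Rmult_1_r (exp (x * ln s))) at 2.
      apply Rmult_le_compat_l; [lra|]. nra.
    + now apply filterlim_power_0.
  (* At infinity s^(2x) e^(-s) <= K, so the boundary term is at most K s^(-x). *)
  - destruct (one_plus_power_sqr_le x Hx) as [K [HK HKs]].
    apply filterlim_0_dominated with (g := fun s => K * / exp (x * ln s)).
    + apply filter_filter.
    + generalize p_infty_pos. apply filter_imp. intros s Hs.
      unfold gamma_weight. replace (x + 1 - 1) with x by ring.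
      rewrite !Rabs_mult, !(Rabs_pos_eq (exp _)) by apply Rlt_le, exp_pos.
      specialize (HKs s Hs).
      pose proof (exp_pos (x * ln s)) as HE. pose proof (exp_pos (- s)).
      specialize (Hb s). pose proof (Rabs_pos (phi s)).
      set (E := exp (x * ln s)) in *. set (e := exp (- s)) in *.
      apply Rle_trans with (E * e * 1).
      { apply Rmult_le_compat_l; [nra|exact Hb]. }
      apply (Rle_div_r _ _ E HE). rewrite Rmult_1_r. nra.
    + apply filterlim_scal_0. now apply filterlim_inv_power_p.
Qed.

(** * Elementary bounds for the cosine and the logarithm *)

Lemma cos_ge_quadratic (u : R) : 1 - u ^ 2 / 2 <= cos u.
Proof.
  (* The half-angle formula reduces the claim to sin^2 v <= v^2. Up to v = 1 the sine is nonnegative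
     and below v; beyond 1 it suffices that sin^2 v <= 1. *)
  assert (H : forall v, 0 <= v -> sin v ^ 2 <= v ^ 2).
  { intros v [Hv | <-]; [|rewrite sin_0; lra].
    pose proof (sin_lt_x v Hv). pose proof (SIN_bound v).
    destruct (Rle_lt_dec v 1) as [L|L]; [|nra].
    assert (0 < sin v) by (apply sin_gt_0; [lra|]; pose proof PI2_1; lra). nra. }
  replace u with (2 * (u / 2)) at 2 by field. rewrite cos_2a_sin.
  assert (sin (u / 2) ^ 2 <= (u / 2) ^ 2); [|lra].
  destruct (Rle_lt_dec 0 (u / 2)) as [L|L]; [now apply H|].
  specialize (H (- (u / 2)) ltac:(lra)). rewrite sin_neg in H. lra.
Qed.

(** With v = (ln u)/2 the right side is (e^v - e^(-v))^2. The mean value theorem writes e^v - e^(-v)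
    as (e^c + e^(-c)) v, and (e^c + e^(-c))^2 = (e^c - e^(-c))^2 + 4 >= 4, while (ln u)^2 = 4
    v^2. *)
Lemma ln_sqr_le (u : R) : 0 < u -> ln u ^ 2 <= u - 2 + / u.
Proof.
  intros Hu. set (v := ln u / 2).
  destruct (MVT_gen (fun w => exp w - exp (- w)) 0 v (fun w => exp w + exp (- w)))
    as [c [_ Hc]].
  - intros w _. auto_derive; [easy|ring].
  - intros w _. apply continuity_pt_filterlim.
    apply (continuous_of_ex_derive (fun w => exp w - exp (- w))). auto_derive. easy.
  - simpl in Hc. rewrite Ropp_0, exp_0 in Hc.
    assert (Hc1 : exp c * exp (- c) = 1) by (rewrite <- exp_plus, <- exp_0; f_equal; ring).
    assert (Hv1 : exp v * exp (- v) = 1) by (rewrite <- exp_plus, <- exp_0; f_equal; ring).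
    assert (Hvu : exp v * exp v = u).
    { rewrite <- exp_plus. unfold v. replace (ln u / 2 + ln u / 2) with (ln u) by field.
      now apply exp_ln. }
    assert (Hvu' : exp (- v) * exp (- v) = / u).
    { rewrite <- Hvu, exp_Ropp. field. apply Rgt_not_eq, exp_pos. }
    replace (u - 2 + / u) with ((exp v - exp (- v)) ^ 2) by nra.
    replace (exp v - exp (- v)) with ((exp c + exp (- c)) * v) by lra.
    replace (ln u) with (2 * v) by (unfold v; field).
    rewrite !Rpow_mult_distr. apply Rmult_le_compat_r; [apply pow2_ge_0|].
    pose proof (pow2_ge_0 (exp c - exp (- c))). nra.
Qed.

(** * Linearity, monotonicity and positivity of integrals over the half line *)

Lemma is_RInt_pos_ext (f g : R -> R) (l : R) :
  (forall s, 0 < s -> f s = g s) -> is_RInt_pos f l -> is_RInt_pos g l.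
Proof.
  intros H. apply is_RInt_gen_ext; try apply filter_filter.
  apply Filter_prod with (1 := at_right_pos) (2 := p_infty_pos).
  intros a b Ha Hb s Hs. apply H. pose proof (Rmin_glb_lt _ _ _ Ha Hb). simpl in Hs. lra.
Qed.

Lemma is_RInt_pos_unique (f : R -> R) (l l' : R) :
  is_RInt_pos f l -> is_RInt_pos f l' -> l = l'.
Proof.
  intros H H'.
  rewrite <- (is_RInt_gen_unique (V := R_CompleteNormedModule) f l H).
  exact (is_RInt_gen_unique (V := R_CompleteNormedModule) f l' H').
Qed.

Lemma is_RInt_pos_lin (a b : R) (f g : R -> R) (lf lg : R) :
  is_RInt_pos f lf -> is_RInt_pos g lg ->
  is_RInt_pos (fun s => a * f s + b * g s) (a * lf + b * lg).
Proof.
  intros Hf Hg.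
  apply (is_RInt_gen_plus (V := R_NormedModule) (fun s => a * f s) (fun s => b * g s)).
  - apply (is_RInt_gen_scal (V := R_NormedModule) f a lf Hf).
  - apply (is_RInt_gen_scal (V := R_NormedModule) g b lg Hg).
Qed.

Lemma is_RInt_pos_le (f g : R -> R) (lf lg : R) :
  (forall s, 0 < s -> f s <= g s) -> is_RInt_pos f lf -> is_RInt_pos g lg -> lf <= lg.
Proof.
  intros H Hf Hg.
  pose proof (is_RInt_pos_lin 1 (-1) _ _ _ _ Hg Hf) as Hd.
  (* The zero function, kept as a combination of [g] and [f]: its norm is dominated by [g - f], so
     the norm inequality for integrals gives the sign of [lg - lf]. *)
  pose proof (is_RInt_pos_lin 0 0 _ _ _ _ Hg Hf) as H0.
  assert (Hgt1 : Rbar_locally p_infty (fun x => 1 < x)) by (exists 1; now intros).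
  assert (Hn : norm (0 * lg + 0 * lf) <= 1 * lg + -1 * lf).
  { refine (RInt_gen_norm (V := R_CompleteNormedModule) _ _ _ _ _ _ H0 Hd);
      apply Filter_prod with (1 := at_right_0_lt_1) (2 := Hgt1); intros a b Ha Hb; simpl.
    - lra.
    - intros s Hs. change (Rabs (0 * g s + 0 * f s) <= 1 * g s + -1 * f s).
      replace (0 * g s + 0 * f s) with 0 by ring. rewrite Rabs_R0.
      specialize (H s ltac:(lra)). lra. }
  pose proof (norm_ge_0 (V := R_NormedModule) (0 * lg + 0 * lf)). lra.
Qed.

(** Strict positivity may be lost in the limit, so the fixed slice over [1, 2] serves as a positive
    lower bound for the integral over every larger interval. *)
Lemma RInt_gamma_weight_gt_0 (x l : R) : is_RInt_pos (gamma_weight x) l -> 0 < l.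
Proof.
  intros Hl.
  pose proof (fun s Hs => continuous_gamma_weight x s Hs) as Hc.
  assert (Hm : 0 < RInt (gamma_weight x) 1 2).
  { apply RInt_gt_0; [lra| |]; intros; [apply gamma_weight_gt_0 | apply Hc; lra]. }
  set (m := RInt (gamma_weight x) 1 2) in *.
  assert (Hlow : filter_prod (at_right 0) (Rbar_locally p_infty) (fun ab : R * R =>
     forall y, is_RInt (gamma_weight x) (fst ab) (snd ab) y -> m <= y)).
  { assert (Hgt1 : Rbar_locally p_infty (fun x => 2 < x)) by (exists 2; now intros).
    apply Filter_prod with (1 := at_right_0_lt_1) (2 := Hgt1). intros a b Ha Hb y Hy. simpl in Hy.
    rewrite <- (is_RInt_unique _ _ _ _ Hy).
    assert (P : forall u v, 0 < u -> u < v -> 0 < RInt (gamma_weight x) u v).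
    { intros u v Hu Huv.
      apply RInt_gt_0; [lra| |]; intros; [apply gamma_weight_gt_0 | apply Hc; lra]. }
    pose proof (RInt_Chasles (gamma_weight x) a 1 b (ex_RInt_pos _ a 1 Hc ltac:(lra) ltac:(lra))
      (ex_RInt_pos _ 1 b Hc ltac:(lra) ltac:(lra))) as E1.
    pose proof (RInt_Chasles (gamma_weight x) 1 2 b (ex_RInt_pos _ 1 2 Hc ltac:(lra) ltac:(lra))
      (ex_RInt_pos _ 2 b Hc ltac:(lra) ltac:(lra))) as E2.
    unfold plus in E1, E2; simpl in E1, E2. fold m in E2.
    pose proof (P a 1 ltac:(lra) ltac:(lra)). pose proof (P 2 b ltac:(lra) ltac:(lra)). lra. }
  destruct (Rlt_le_dec 0 l) as [L|L]; [exact L|exfalso].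
  assert (HB : locally l (fun y => y < m)).
  { exists (mkposreal m Hm). intros y Hy. change (Rabs (y - l) < m) in Hy.
    apply Rabs_def2 in Hy. lra. }
  destruct (filter_ex _ (filter_and _ _ Hlow (Hl _ HB))) as [ab [H1 [y [Hy Hym]]]].
  specialize (H1 y Hy). lra.
Qed.

(** * Complex Gamma through its real and imaginary parts *)

Definition gamma_re (x y s : R) : R := gamma_weight x s * cos (y * ln s).
Definition gamma_im (x y s : R) : R := gamma_weight x s * sin (y * ln s).

Lemma is_RInt_gen_C (f : R -> C) (Fa Fb : (R -> Prop) -> Prop)
    (FFa : Filter Fa) (FFb : Filter Fb) (lr li : R) :
  is_RInt_gen (fun s => Re (f s)) Fa Fb lr -> is_RInt_gen (fun s => Im (f s)) Fa Fb li ->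
  is_RInt_gen (V := C_R_NormedModule) f Fa Fb (lr, li).
Proof.
  intros Hr Hi P [eps HP].
  pose proof (Hr _ (locally_ball lr eps)) as H1. pose proof (Hi _ (locally_ball li eps)) as H2.
  unfold filtermapi in *. generalize (filter_and _ _ H1 H2).
  apply filter_imp. intros [a b] [[u [Hu Bu]] [v [Hv Bv]]]. simpl in *.
  exists (u, v). split.
  - apply (is_RInt_fct_extend_pair (U := R_NormedModule) (V := R_NormedModule)); assumption.
  - apply HP. split; assumption.
Qed.

(** Reduces [CGamma] to two real integrals, each a bounded trigonometric factor against the weight.
    It also shows that the integral defining [CGamma] converges for 0 < Re z. *)
Lemma CGamma_components (z : C) : 0 < Re z ->
  exists lr li, is_RInt_pos (gamma_re (Re z) (Im z)) lr /\
    is_RInt_pos (gamma_im (Re z) (Im z)) li /\ CGamma z = (lr, li).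
Proof.
  intros Hz.
  destruct (ex_RInt_gamma_weight (Re z) (fun s => cos (Im z * ln s)) Hz) as [lr Hr].
  { intros s Hs. apply continuous_of_ex_derive. auto_derive. lra. }
  { intros s. apply Rabs_le, COS_bound. }
  destruct (ex_RInt_gamma_weight (Re z) (fun s => sin (Im z * ln s)) Hz) as [li Hi].
  { intros s Hs. apply continuous_of_ex_derive. auto_derive. lra. }
  { intros s. apply Rabs_le, SIN_bound. }
  exists lr, li. split; [exact Hr|split; [exact Hi|]].
  unfold CGamma. apply (is_RInt_gen_unique (V := C_R_CompleteNormedModule)).
  apply is_RInt_gen_C; try apply filter_filter.
  - apply is_RInt_pos_ext with (2 := Hr). intros s Hs. destruct z as [x y].
    unfold gamma_weight. simpl. unfold Re, Im; simpl.
    replace (x + -(1)) with (x - 1) by ring. replace (y + -0) with y by ring. ring.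
  - apply is_RInt_pos_ext with (2 := Hi). intros s Hs. destruct z as [x y].
    unfold gamma_weight. simpl. unfold Re, Im; simpl.
    replace (x + -(1)) with (x - 1) by ring. replace (y + -0) with y by ring. ring.
Qed.

(** This is Gamma(z+1) = z Gamma(z) in components, with z = x + i y and Gamma(z) = c + i s. It is
    the integration by parts for phi = cos(y ln u) and phi = sin(y ln u), whose u phi' are -y sin(y
    ln u) and y cos(y ln u). *)
Lemma gamma_components_succ (x y c s c1 s1 : R) : 0 < x ->
  is_RInt_pos (gamma_re x y) c -> is_RInt_pos (gamma_im x y) s ->
  is_RInt_pos (gamma_re (x + 1) y) c1 -> is_RInt_pos (gamma_im (x + 1) y) s1 ->
  c1 = x * c - y * s /\ s1 = x * s + y * c.
Proof.
  intros Hx Hc Hs Hc1 Hs1. split.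
  - pose proof (is_RInt_gamma_boundary x (fun s => cos (y * ln s))
      (fun s => - (y / s) * sin (y * ln s)) Hx) as B.
    pose proof (is_RInt_pos_lin 1 (-1) _ _ _ _
      (is_RInt_pos_lin x (-y) _ _ _ _ Hc Hs) Hc1) as L.
    enough (0 = 1 * (x * c + - y * s) + -1 * c1) by lra.
    refine (is_RInt_pos_unique _ _ _ (B _ _ _) (is_RInt_pos_ext _ _ _ _ L)).
    + intros u Hu. auto_derive; [lra|]. field. lra.
    + intros u Hu. apply continuous_of_ex_derive. auto_derive. repeat split; lra.
    + intros u. apply Rabs_le, COS_bound.
    + intros u Hu. unfold gamma_re, gamma_im. field. lra.
  - pose proof (is_RInt_gamma_boundary x (fun s => sin (y * ln s))
      (fun s => (y / s) * cos (y * ln s)) Hx) as B.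
    pose proof (is_RInt_pos_lin 1 (-1) _ _ _ _
      (is_RInt_pos_lin x y _ _ _ _ Hs Hc) Hs1) as L.
    enough (0 = 1 * (x * s + y * c) + -1 * s1) by lra.
    refine (is_RInt_pos_unique _ _ _ (B _ _ _) (is_RInt_pos_ext _ _ _ _ L)).
    + intros u Hu. auto_derive; [lra|]. field. lra.
    + intros u Hu. apply continuous_of_ex_derive. auto_derive. repeat split; lra.
    + intros u. apply Rabs_le, SIN_bound.
    + intros u Hu. unfold gamma_re, gamma_im. field. lra.
Qed.

Lemma CGamma_succ_neq_0 (z : C) : 0 < Re z -> CGamma (z + 1)%C <> 0 -> CGamma z <> 0.
Proof.
  intros Hz Hn H0. apply Hn.
  destruct (CGamma_components z Hz) as [c [s [Hc [Hs E]]]].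
  destruct (CGamma_components (z + 1)%C) as [c1 [s1 [Hc1 [Hs1 E1]]]].
  { destruct z; unfold Re in *; simpl in *; lra. }
  rewrite E in H0. injection H0 as -> ->.
  replace (Re (z + 1)%C) with (Re z + 1) in Hc1, Hs1 by reflexivity.
  replace (Im (z + 1)%C) with (Im z) in Hc1, Hs1 by (unfold Im; simpl; ring).
  destruct (gamma_components_succ _ _ _ _ _ _ Hz Hc Hs Hc1 Hs1) as [-> ->].
  rewrite E1. unfold RtoC. f_equal; ring.
Qed.

Lemma RInt_gamma_weight_succ (x g g1 : R) : 0 < x ->
  is_RInt_pos (gamma_weight x) g -> is_RInt_pos (gamma_weight (x + 1)) g1 -> g1 = x * g.
Proof.
  intros Hx Hg Hg1.
  pose proof (is_RInt_gamma_boundary x (fun _ => 1) (fun _ => 0) Hx) as B.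
  pose proof (is_RInt_pos_lin x (-1) _ _ _ _ Hg Hg1) as L.
  enough (0 = x * g + -1 * g1) by lra.
  refine (is_RInt_pos_unique _ _ _ (B _ _ _) (is_RInt_pos_ext _ _ _ _ L)).
  - intros u Hu. apply (is_derive_const (K := R_AbsRing) (V := R_NormedModule)).
  - intros u Hu. apply continuous_const.
  - intros u. rewrite Rabs_R1. lra.
  - intros u Hu. ring.
Qed.

Lemma ex_RInt_gamma (x : R) : 0 < x -> exists g, is_RInt_pos (gamma_weight x) g.
Proof.
  intros Hx. destruct (ex_RInt_gamma_weight x (fun _ => 1) Hx) as [g Hg].
  - intros s _. apply continuous_const.
  - intros s. rewrite Rabs_R1. lra.
  - exists g. apply is_RInt_pos_ext with (2 := Hg). intros s _. ring.
Qed.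

Lemma CGamma_neq_0_large (z : C) : 1 < Re z -> Im z ^ 2 < 2 * (Re z - 1) -> CGamma z <> 0.
Proof.
  intros Hx Hy H0. destruct (CGamma_components z ltac:(lra)) as [c [s [Hc [Hs E]]]].
  rewrite E in H0. injection H0 as -> ->. clear E.
  set (x := Re z) in *. set (y := Im z) in *.
  destruct (ex_RInt_gamma x ltac:(lra)) as [g Hg].
  destruct (ex_RInt_gamma (x + 1) ltac:(lra)) as [g1 Hg1].
  destruct (ex_RInt_gamma (x - 1) ltac:(lra)) as [g0 Hg0].
  pose proof (RInt_gamma_weight_succ x g g1 ltac:(lra) Hg Hg1) as E1.
  assert (E0 : g = (x - 1) * g0).
  { apply RInt_gamma_weight_succ; [lra|exact Hg0|]. now replace (x - 1 + 1) with x by ring. }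
  pose proof (RInt_gamma_weight_gt_0 _ _ Hg0) as P0.
  (* This combination is Re(x^(-iy) Gamma(z)); both integrals are 0 under the assumption to be
     refuted. *)
  pose proof (is_RInt_pos_lin (cos (y * ln x)) (sin (y * ln x)) _ _ _ _ Hc Hs) as U.
  (* Integral of the minorant s^(x-1) e^(-s) (1 - y^2/2 (s/x - 2 + x/s)). The factors s and 1/s turn
     the weight into those of Gamma(x+1) and Gamma(x-1), hence 1 < x. The coefficient 0 only pads a
     binary combination. *)
  pose proof (is_RInt_pos_lin 1 (- (y ^ 2 / 2)) _ _ _ _
    Hg (is_RInt_pos_lin 1 1 _ _ _ _
          (is_RInt_pos_lin (/ x) (-2) _ _ _ _ Hg1 Hg) (is_RInt_pos_lin x 0 _ _ _ _ Hg0 Hg0))) as L.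
  assert (Hle := fun H => is_RInt_pos_le _ _ _ _ H L U).
  assert (Hneg : 1 * g + - (y ^ 2 / 2) * (1 * (/ x * g1 + -2 * g) + 1 * (x * g0 + 0 * g0)) <= 0).
  { eapply Rle_trans; [apply Hle | lra]. clear - Hx. intros u Hu.
    unfold gamma_re, gamma_im.
    assert (W1 : gamma_weight (x + 1) u = u * gamma_weight x u).
    { unfold gamma_weight. rewrite (exp_ln_over _ u Hu).
      replace (x + 1 - 1 - 1) with (x - 1) by ring. ring. }
    assert (W0 : gamma_weight x u = u * gamma_weight (x - 1) u).
    { unfold gamma_weight. rewrite (exp_ln_over _ u Hu). ring. }
    assert (W0' : gamma_weight (x - 1) u = gamma_weight x u / u) by (rewrite W0; field; lra).
    rewrite W1, W0'. pose proof (gamma_weight_gt_0 x u) as Wp.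
    set (w := gamma_weight x u) in *.
    replace (cos (y * ln x) * (w * cos (y * ln u)) + sin (y * ln x) * (w * sin (y * ln u)))
      with (w * cos (y * ln (u / x))).
    2:{ rewrite ln_div by lra. rewrite Rmult_minus_distr_l, cos_minus. ring. }
    replace (1 * w + - (y ^ 2 / 2)
        * (1 * (/ x * (u * w) + -2 * w) + 1 * (x * (w / u) + 0 * (w / u))))
      with (w * (1 - y ^ 2 * (u / x - 2 + / (u / x)) / 2)) by (field; lra).
    apply Rmult_le_compat_l; [lra|].
    pose proof (cos_ge_quadratic (y * ln (u / x))) as Q.
    assert (Hux : 0 < u / x) by (apply Rdiv_lt_0_compat; lra).
    pose proof (ln_sqr_le _ Hux) as Q2. rewrite Rpow_mult_distr in Q.
    apply Rmult_le_compat_l with (r := y ^ 2) in Q2; [lra|apply pow2_ge_0]. }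
  (* With everything expressed by g0 = Gamma(x-1), the lower bound becomes g0 (x - 1 - y^2/2), which
     is positive. *)
  rewrite E1, E0 in Hneg.
  replace (1 * ((x - 1) * g0) + - (y ^ 2 / 2)
      * (1 * (/ x * (x * ((x - 1) * g0)) + -2 * ((x - 1) * g0)) + 1 * (x * g0 + 0 * g0)))
    with (g0 * ((x - 1) - y ^ 2 / 2)) in Hneg by (field; lra).
  nra.
Qed.

(** Shifting z by 1 keeps Im z and raises Re z, so after finitely many shifts the large-real-part
    case applies. *)
Lemma CGamma_neq_0 (z : C) : 0 < Re z -> CGamma z <> 0.
Proof.
  intros Hz.
  assert (H : forall n z, 0 < Re z -> Im z ^ 2 < 2 * (Re z + INR n - 1) -> 1 < Re z + INR n ->
    CGamma z <> 0).
  { clear. induction n as [|n IH]; intros z Hz Hy H1.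
    - simpl in *. apply CGamma_neq_0_large; lra.
    - apply CGamma_succ_neq_0; [assumption|]. rewrite S_INR in *.
      assert (Re (z + 1)%C = Re z + 1) as E by reflexivity.
      assert (Im (z + 1)%C = Im z) as E' by (unfold Im; simpl; ring).
      apply IH; rewrite ?E, ?E'; lra. }
  destruct (INR_unbounded (Im z ^ 2 + 1)) as [n Hn].
  pose proof (pow2_ge_0 (Im z)). apply (H n); lra.
Qed.

(** * Local inversion of a complex polynomial *)

(** Strict differentiability at 0 with derivative 0. Controlling differences, and not only [S e]
    itself, is what a contraction argument needs; together with [S 0 = 0] it also gives S e =
    o(e). *)
Definition strictly_small (S : C -> C) : Prop :=
  forall eta, 0 < eta -> exists d, 0 < d /\
    forall e e', Cmod e < d -> Cmod e' < d -> Cmod (S e - S e')%C <= eta * Cmod (e - e')%C.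

Lemma strictly_small_plus (S T : C -> C) :
  strictly_small S -> strictly_small T -> strictly_small (fun e => (S e + T e)%C).
Proof.
  intros HS HT eta Heta.
  destruct (HS (eta / 2) ltac:(lra)) as [d1 [Hd1 H1]].
  destruct (HT (eta / 2) ltac:(lra)) as [d2 [Hd2 H2]].
  exists (Rmin d1 d2). split; [now apply Rmin_glb_lt|]. intros e e' He He'.
  pose proof (Rmin_l d1 d2). pose proof (Rmin_r d1 d2).
  specialize (H1 e e' ltac:(lra) ltac:(lra)). specialize (H2 e e' ltac:(lra) ltac:(lra)).
  replace (S e + T e - (S e' + T e'))%C with ((S e - S e') + (T e - T e'))%C by ring.
  eapply Rle_trans; [apply Cmod_triangle|]. lra.
Qed.

Lemma Cpow_lipschitz (k : nat) (e e' : C) :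
  Cmod e <= 1 -> Cmod e' <= 1 -> Cmod (e ^ k - e' ^ k)%C <= INR k * Cmod (e - e')%C.
Proof.
  intros He He'. induction k as [|k IH].
  - simpl. replace (1 - 1)%C with (RtoC 0) by ring. rewrite Cmod_0. lra.
  - rewrite S_INR. cbn [Cpow].
    replace (e * e ^ k - e' * e' ^ k)%C with (e * (e ^ k - e' ^ k) + (e - e') * e' ^ k)%C by ring.
    eapply Rle_trans; [apply Cmod_triangle|]. rewrite !Cmod_mult, Cmod_pow.
    assert (Cmod e' ^ k <= 1).
    { rewrite <- (pow1 k). apply pow_incr. split; [apply Cmod_ge_0|assumption]. }
    pose proof (Cmod_ge_0 (e - e')). pose proof (Cmod_ge_0 (e ^ k - e' ^ k)).
    pose proof (Cmod_ge_0 e). nra.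
Qed.

Lemma strictly_small_monomial (c : C) (k : nat) : strictly_small (fun e => (c * e ^ (2 + k))%C).
Proof.
  (* On the disc of radius d <= 1, the map c e^(j+1) with j = k + 1 has Lipschitz constant at most
     |c| d (j+1). The number M exceeds |c| (j+1) and is positive, so d <= eta/M suffices. *)
  intros eta Heta. set (M := (Cmod c + 1) * (INR (S k) + 1)).
  pose proof (Cmod_ge_0 c) as Hc. pose proof (pos_INR (S k)) as Hk.
  assert (HM : 0 < M) by (unfold M; nra).
  exists (Rmin 1 (eta / M)). split.
  { apply Rmin_glb_lt; [lra|]. now apply Rdiv_lt_0_compat. }
  intros e e' He He'.
  pose proof (Rmin_l 1 (eta / M)). pose proof (Rmin_r 1 (eta / M)).
  set (d := Rmin 1 (eta / M)) in *.
  assert (Hd : d * M <= eta) by (apply (Rle_div_r d eta M HM); lra).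
  change (2 + k)%nat with (S (S k)). set (j := S k) in *. cbn [Cpow].
  replace (c * (e * e ^ j) - c * (e' * e' ^ j))%C
    with (c * (e * (e ^ j - e' ^ j) + (e - e') * e' ^ j))%C by ring.
  rewrite Cmod_mult.
  pose proof (Cpow_lipschitz j e e' ltac:(lra) ltac:(lra)) as L.
  assert (Hp : Cmod (e' ^ j) <= d).
  { unfold j. cbn [Cpow]. rewrite Cmod_mult, Cmod_pow.
    assert (Cmod e' ^ k <= 1).
    { rewrite <- (pow1 k). apply pow_incr. split; [apply Cmod_ge_0|lra]. }
    pose proof (Cmod_ge_0 e'). nra. }
  set (D := Cmod (e - e')) in *. assert (HD : 0 <= D) by apply Cmod_ge_0.
  assert (T : Cmod (e * (e ^ j - e' ^ j) + (e - e') * e' ^ j)%C <= d * (INR j + 1) * D).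
  { eapply Rle_trans; [apply Cmod_triangle|]. rewrite !Cmod_mult. fold D.
    pose proof (Cmod_ge_0 e). pose proof (Cmod_ge_0 (e ^ j - e' ^ j)).
    assert (Cmod e * Cmod (e ^ j - e' ^ j) <= d * (INR j * D)).
    { apply Rmult_le_compat; lra. }
    assert (D * Cmod (e' ^ j) <= D * d) by (apply Rmult_le_compat_l; lra). lra. }
  apply Rle_trans with (Cmod c * (d * (INR j + 1) * D)); [now apply Rmult_le_compat_l|].
  apply Rle_trans with (d * M * D); [|now apply Rmult_le_compat_r].
  unfold M.
  replace (Cmod c * (d * (INR j + 1) * D)) with (Cmod c * (d * (INR j + 1)) * D) by ring.
  apply Rmult_le_compat_r; [assumption|].
  assert (0 <= d * (INR j + 1)); [|lra]. pose proof (Cmod_ge_0 e). nra.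
Qed.

(** The upper index [1 + n] guarantees a linear term; all later monomials have degree at least 2 and
    are collected in [S]. *)
Lemma polynomial_linear_part (d : nat -> C) (n : nat) :
  exists S, strictly_small S /\ S 0 = 0 /\
    forall e, sum_n (fun k => d k * e ^ k)%C (1 + n) = (d 0%nat + d 1%nat * e + S e)%C.
Proof.
  induction n as [|n [S [HS [H0 H]]]].
  - exists (fun _ => RtoC 0). repeat split.
    + intros eta Heta. exists 1. split; [lra|]. intros e e' _ _.
      replace (0 - 0)%C with (RtoC 0) by ring. rewrite Cmod_0.
      pose proof (Cmod_ge_0 (e - e')). nra.
    + intros e. rewrite sum_Sn, sum_O. unfold plus; simpl. ring.
  - exists (fun e => (S e + d (2 + n)%nat * e ^ (2 + n))%C). repeat split.
    + apply strictly_small_plus; [exact HS | apply strictly_small_monomial].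
    + rewrite H0. cbn [Cpow Nat.add]. ring.
    + intros e. change (1 + Datatypes.S n)%nat with (Datatypes.S (1 + n)).
      rewrite sum_Sn, H. unfold plus; simpl. ring.
Qed.

Lemma Clim_seq_cauchy (z : nat -> C) (r : R) : 0 < r ->
  (forall n, Cmod (z (S n) - z n)%C <= r * (1 / 2) ^ n) ->
  exists l, forall eps, 0 < eps -> exists N, forall n, (N <= n)%nat -> Cmod (z n - l)%C < eps.
Proof.
  intros Hr Hz.
  (* Keeping the factor 1 - 2^(-k) of the partial geometric sum lets the induction on k close. *)
  assert (Hgeo : forall n k, Cmod (z (n + k)%nat - z n)%C <= 2 * r * (1 / 2) ^ n * (1 - (1 / 2) ^ k)).
  { intros n. induction k as [|k IH].
    - rewrite Nat.add_0_r. replace (z n - z n)%C with (RtoC 0) by ring. rewrite Cmod_0. simpl. lra.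
    - replace (n + S k)%nat with (S (n + k)) by lia.
      replace (z (S (n + k)) - z n)%C with ((z (S (n + k)) - z (n + k)%nat) + (z (n + k)%nat - z n))%C
        by ring.
      eapply Rle_trans; [apply Cmod_triangle|]. specialize (Hz (n + k)%nat).
      rewrite pow_add in Hz. cbn [pow]. lra. }
  assert (Hpow : forall n, 0 < (1 / 2) ^ n) by (intros; apply pow_lt; lra).
  assert (Hsm : forall eps, 0 < eps -> exists N, forall n, (N <= n)%nat -> 2 * r * (1 / 2) ^ n < eps).
  { intros eps He. destruct (pow_lt_1_zero (1 / 2) ltac:(rewrite Rabs_pos_eq; lra)
      (eps / (2 * r)) ltac:(apply Rdiv_lt_0_compat; lra)) as [N HN].
    exists N. intros n Hn. specialize (HN n Hn). rewrite Rabs_pos_eq in HN by (apply Rlt_le, Hpow).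
    apply (Rmult_lt_compat_l (2 * r)) in HN; [|lra].
    replace (2 * r * (eps / (2 * r))) with eps in HN by (field; lra). exact HN. }
  destruct (proj1 (filterlim_locally_cauchy (U := C_R_CompleteNormedModule) (F := eventually) z))
    as [l Hl].
  - intros eps. destruct (Hsm (eps / 2) ltac:(pose proof (cond_pos eps); lra)) as [N HN].
    exists (fun n => (N <= n)%nat). split; [now exists N|].
    assert (HC : forall u, (N <= u)%nat -> Cmod (z u - z N)%C < eps / 2).
    { intros u Hu. replace u with (N + (u - N))%nat by lia.
      eapply Rle_lt_trans; [apply Hgeo|]. eapply Rle_lt_trans; [|apply (HN N (Nat.le_refl _))].
      specialize (Hpow N) as P1. specialize (Hpow (u - N)%nat) as P2.
      rewrite <- (Rmult_1_r (2 * r * (1 / 2) ^ N)) at 2.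
      apply Rmult_le_compat_l; [nra|lra]. }
    intros u v Hu Hv. apply C_NormedModule_mixin_compat1.
    change (minus (z v) (z u)) with (z v - z u)%C.
    replace (z v - z u)%C with ((z v - z N) + - (z u - z N))%C by ring.
    eapply Rle_lt_trans; [apply Cmod_triangle|]. rewrite Cmod_opp.
    pose proof (HC u Hu). pose proof (HC v Hv). lra.
  - exists l. intros eps He.
    (* Balls of the uniform structure on [C] are taken componentwise; they control the modulus up to
       a factor sqrt 2. *)
    assert (Hs : 0 < sqrt 2) by (apply sqrt_lt_R0; lra).
    destruct (proj1 (filterlim_locally (U := C_UniformSpace) z l) Hl
      (mkposreal _ (Rdiv_lt_0_compat _ _ He Hs))) as [N HN].
    exists N. intros n Hn. specialize (HN n Hn).
    apply C_NormedModule_mixin_compat2 in HN.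
    change (minus (z n) l) with (z n - l)%C in HN. simpl in HN.
    replace (sqrt 2 * (eps / sqrt 2)) with eps in HN by (field; lra). exact HN.
Qed.

(** A solution is a fixed point of T e = (w - S e)/c, obtained by iterating T from 0 in a closed
    disc where T contracts by 1/2. *)
Lemma local_inverse (c : C) (S : C -> C) : c <> 0 -> strictly_small S -> S 0 = 0 ->
  forall d, 0 < d -> exists om, 0 < om /\
    forall w, Cmod w < om -> exists e, Cmod e < d /\ (c * e + S e = w)%C.
Proof.
  intros Hc HS H0 d Hd. pose proof (proj1 (Cmod_gt_0 c) Hc) as Hcm.
  (* Lipschitz constant |c|/2 for S is constant 1/2 for T. Halving the minimum below puts the closed
     disc of radius r inside both open discs. *)
  destruct (HS (Cmod c / 2) ltac:(lra)) as [d1 [Hd1 H1]].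
  set (r := Rmin d d1 / 2).
  assert (Hmin : 0 < Rmin d d1) by now apply Rmin_glb_lt.
  assert (Hr : 0 < r /\ r < d /\ r < d1).
  { pose proof (Rmin_l d d1). pose proof (Rmin_r d d1). unfold r. lra. }
  destruct Hr as [Hr [Hrd Hrd1]].
  (* Then |T e| <= |w|/|c| + |S e|/|c| <= r/2 + r/2, so T preserves the disc. *)
  exists (Cmod c * r / 2). split; [nra|]. intros w Hw.
  set (T := fun e => ((w - S e) / c)%C).
  assert (HTd : forall e e', Cmod e <= r -> Cmod e' <= r ->
      Cmod (T e - T e')%C <= 1 / 2 * Cmod (e - e')%C).
  { intros e e' He He'. unfold T.
    replace ((w - S e) / c - (w - S e') / c)%C with ((S e' - S e) / c)%C by (field; exact Hc).
    rewrite Cmod_div by exact Hc. apply (Rle_div_l _ _ _ Hcm).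
    specialize (H1 e' e ltac:(lra) ltac:(lra)).
    replace (e - e')%C with (- (e' - e))%C by ring. rewrite Cmod_opp. lra. }
  assert (HTr : forall e, Cmod e <= r -> Cmod (T e) <= r).
  { intros e He. unfold T. rewrite Cmod_div by exact Hc. apply (Rle_div_l _ _ _ Hcm).
    specialize (H1 e 0 ltac:(lra) ltac:(rewrite Cmod_0; lra)).
    rewrite H0 in H1. replace (S e - 0)%C with (S e) in H1 by ring.
    replace (e - 0)%C with e in H1 by ring.
    unfold Cminus. eapply Rle_trans; [apply Cmod_triangle|]. rewrite Cmod_opp. nra. }
  set (z := fix z n := match n with O => RtoC 0 | Datatypes.S n => T (z n) end).
  assert (Hzr : forall n, Cmod (z n) <= r).
  { induction n; simpl; [rewrite Cmod_0; lra | now apply HTr]. }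
  destruct (Clim_seq_cauchy z r Hr) as [l Hl].
  { induction n as [|n IH].
    - change (z 1%nat) with (T 0). change (z 0%nat) with (RtoC 0).
      replace (T 0 - 0)%C with (T 0) by ring. simpl. rewrite Rmult_1_r. apply (Hzr 1%nat).
    - change (z (Datatypes.S (Datatypes.S n))) with (T (z (Datatypes.S n))).
      change (z (Datatypes.S n)) with (T (z n)) at 2.
      eapply Rle_trans; [apply HTd; apply Hzr|]. cbn [pow]. lra. }
  assert (Hlr : Cmod l <= r).
  { apply le_epsilon. intros eps He. destruct (Hl eps He) as [N HN].
    specialize (HN N (Nat.le_refl _)). specialize (Hzr N).
    replace l with (z N + - (z N - l))%C by ring.
    eapply Rle_trans; [apply Cmod_triangle|]. rewrite Cmod_opp. lra. }
  assert (HT : T l = l).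
  { assert (HE : Cmod (T l - l)%C = 0).
    { apply Rle_antisym; [|apply Cmod_ge_0]. apply le_epsilon. intros eps He.
      destruct (Hl (eps / 2) ltac:(lra)) as [N HN].
      pose proof (HN N (Nat.le_refl _)) as B1. pose proof (HN (Datatypes.S N) ltac:(lia)) as B2.
      change (z (Datatypes.S N)) with (T (z N)) in B2.
      replace (T l - l)%C with (- (T (z N) - T l) + (T (z N) - l))%C by ring.
      eapply Rle_trans; [apply Cmod_triangle|]. rewrite Cmod_opp.
      pose proof (HTd (z N) l (Hzr N) Hlr). pose proof (Cmod_ge_0 (z N - l)). lra. }
    apply Cmod_eq_0 in HE. replace (T l) with (T l - l + l)%C by ring. rewrite HE. ring. }
  exists l. split; [lra|]. unfold T in HT. rewrite <- HT at 1. field. exact Hc.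
Qed.

(** * Increments of the fractional integral *)

(** Convergence measured by the modulus, which is multiplicative and so easier to estimate with than
    the componentwise balls. *)
Definition Clim {T : Type} (F : (T -> Prop) -> Prop) (f : T -> C) (l : C) : Prop :=
  forall eps, 0 < eps -> F (fun x => Cmod (f x - l)%C < eps).

Lemma filterlim_Clim {T : Type} (F : (T -> Prop) -> Prop) (FF : Filter F) (f : T -> C) (l : C) :
  Clim F f l -> filterlim f F (locally (l : C_UniformSpace)).
Proof.
  intros H. apply filterlim_locally. intros eps.
  generalize (H eps (cond_pos eps)). apply filter_imp. intros x Hx.
  now apply C_NormedModule_mixin_compat1.
Qed.

Lemma Clim_mult {T : Type} (F : (T -> Prop) -> Prop) (FF : Filter F) (f g : T -> C) (l m : C) :
  Clim F f l -> Clim F g m -> Clim F (fun x => (f x * g x)%C) (l * m)%C.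
Proof.
  intros Hf Hg eps He.
  pose proof (Cmod_ge_0 l) as Hl. pose proof (Cmod_ge_0 m) as Hm.
  set (M := 1 + Cmod l + Cmod m). assert (HM : 0 < M) by (unfold M; lra).
  (* Since d <= 1, the three error terms add up to at most d (1 + |l| + |m|) <= eps/2. *)
  set (d := Rmin 1 (eps / (2 * M))).
  assert (Hq : 0 < eps / (2 * M)) by (apply Rdiv_lt_0_compat; lra).
  assert (Hd : 0 < d) by (apply Rmin_glb_lt; lra).
  assert (Hd1 : d <= 1) by apply Rmin_l.
  assert (HdM : d * (2 * M) <= eps).
  { apply (Rle_div_r d eps (2 * M)); [lra|]. apply Rmin_r. }
  generalize (filter_and _ _ (Hf d Hd) (Hg d Hd)). apply filter_imp. intros x [H1 H2].
  replace (f x * g x - l * m)%C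
    with ((f x - l) * (g x - m) + (l * (g x - m) + m * (f x - l)))%C by ring.
  eapply Rle_lt_trans; [apply Cmod_triangle|].
  eapply Rle_lt_trans; [apply Rplus_le_compat_l, Cmod_triangle|]. rewrite !Cmod_mult.
  pose proof (Cmod_ge_0 (f x - l)). pose proof (Cmod_ge_0 (g x - m)).
  unfold M in *. nra.
Qed.

Lemma Clim_const {T : Type} (F : (T -> Prop) -> Prop) (FF : Filter F) (l : C) :
  Clim F (fun _ => l) l.
Proof.
  intros eps He. apply filter_forall. intros _.
  replace (l - l)%C with (RtoC 0) by ring. now rewrite Cmod_0.
Qed.

(** Projection onto [lo, hi]. Composing with it turns an integrand continuous relative to its domain
    into one continuous on the whole line, as the integration lemmas require. *)
Definition clamp (lo hi x : R) : R := Rmax lo (Rmin hi x).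

Lemma clamp_in lo hi x : lo <= hi -> lo <= clamp lo hi x <= hi.
Proof.
  intros H. unfold clamp. split; [apply Rmax_l|].
  apply Rmax_lub; [exact H | apply Rmin_l].
Qed.

Lemma clamp_id lo hi x : lo <= x <= hi -> clamp lo hi x = x.
Proof. intros H. unfold clamp. rewrite Rmin_right, Rmax_right; lra. Qed.

Lemma continuous_clamp lo hi x : continuous (clamp lo hi) x.
Proof.
  apply filterlim_locally. intros eps. exists eps. intros y Hy.
  change (Rabs (clamp lo hi y - clamp lo hi x) < eps). change (Rabs (y - x) < eps) in Hy.
  eapply Rle_lt_trans; [|exact Hy]. clear Hy.
  unfold clamp, Rmax, Rmin, Rabs.
  repeat destruct Rle_dec; repeat destruct Rcase_abs; lra.
Qed.

Lemma continuous_clamped_Vintegrand (alpha lo hi : R) (D : R -> Prop) (f : R -> C) (x : R) :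
  0 < lo <= hi -> (forall y, lo <= y <= hi -> D y) ->
  continuous_on (U := C_UniformSpace) D f ->
  continuous (U := C_R_NormedModule) (fun y => Vintegrand alpha f (clamp lo hi y)) x.
Proof.
  intros Hlo HD Hf.
  apply continuous_ext with
    (f := fun y =>
      scal (/ Rpower (clamp lo hi y) (1 - alpha)) (f (clamp lo hi y) : C_R_NormedModule)).
  { intros y. unfold Vintegrand.
    assert (Hp : Rpower (clamp lo hi y) (1 - alpha) <> 0) by apply Rgt_not_eq, exp_pos.
    unfold Cdiv. rewrite <- RtoC_inv by exact Hp.
    destruct (f (clamp lo hi y)) as [u v]. unfold RtoC, Cmult, scal; simpl.
    unfold prod_scal, scal; simpl. unfold mult; simpl. f_equal; ring. }
  apply (continuous_scal (K := R_AbsRing) (V := C_R_NormedModule)).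
  - apply (continuous_comp (clamp lo hi) (fun u => / Rpower u (1 - alpha))).
    + apply continuous_clamp.
    + pose proof (clamp_in lo hi x ltac:(lra)) as [H _].
      apply continuous_of_ex_derive. unfold Rpower. auto_derive.
      repeat split; [lra | apply Rgt_not_eq, exp_pos].
  - pose proof (clamp_in lo hi x ltac:(lra)) as Hx.
    refine (filterlim_comp _ _ _ (clamp lo hi) f _ _ _ _ (Hf _ (HD _ Hx))).
    (* Continuity of [f] is only relative to [D]; the clamped points lie in [D], so the relative
       neighbourhood is reached. *)
    intros P HP. pose proof (continuous_clamp lo hi x _ HP) as HQ.
    unfold filtermap in *. revert HQ. apply filter_imp. intros y Hy. apply Hy, HD, clamp_in. lra.
Qed.

Lemma is_RInt_clamped (g : R -> C) (lo hi u v : R) (l : C) :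
  lo <= u <= hi -> lo <= v <= hi ->
  is_RInt (V := C_R_NormedModule) (fun x => g (clamp lo hi x)) u v l ->
  is_RInt (V := C_R_NormedModule) g u v l.
Proof.
  intros Hu Hv. apply is_RInt_ext. intros x Hx.
  pose proof (Rmin_glb _ _ _ (proj1 Hu) (proj1 Hv)).
  pose proof (Rmax_lub _ _ _ (proj2 Hu) (proj2 Hv)).
  rewrite clamp_id by lra. reflexivity.
Qed.

Lemma is_RInt_primitive_minus {V : CompleteNormedModule R_AbsRing} (g : R -> V) (t u v : R) :
  (forall x, continuous g x) -> is_RInt g u v (minus (RInt g t v) (RInt g t u)).
Proof.
  intros Hc.
  assert (Hex : forall u v, ex_RInt g u v) by (intros; apply ex_RInt_continuous; auto).
  rewrite <- (RInt_Chasles g t u v) by apply Hex.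
  unfold minus. rewrite plus_comm, plus_assoc, plus_opp_l, plus_zero_l.
  now apply RInt_correct.
Qed.

(* Covers both [t > a], where the integral is split at [t], and [t = a], where
   [f] is continuous at the left end point and the integral is proper. *)
Lemma Vint_increment (a b t alpha : R) (f : R -> C) :
  0 <= a -> a < b -> a <= t -> t <= b -> 0 < t ->
  continuous_on (fun x : R => a < x <= b \/ x = t) f ->
  ex_Vint alpha a f t ->
  exists lo d, 0 < lo <= b /\ 0 < d /\ lo <= t /\
    (forall x, lo <= x <= b -> a < x <= b \/ x = t) /\
    forall s, a <= s <= b -> Rabs (s - t) < d ->
      RInt_gen (V := C_R_CompleteNormedModule) (Vintegrand alpha f) (at_right a) (at_point s) =
      Cplus
        (RInt_gen (V := C_R_CompleteNormedModule) (Vintegrand alpha f) (at_right a) (at_point t))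
        (RInt (V := C_R_CompleteNormedModule)
           (fun x => Vintegrand alpha f (clamp lo b x)) t s).
Proof.
  intros ha hab hat htb ht hf hex.
  destruct (Rle_lt_or_eq_dec a t hat) as [Hlt|Heq].
  (* Both constants keep s above the midpoint of a and t, away from the possible singularity at
     a. *)
  - exists ((a + t) / 2), ((t - a) / 2).
    assert (Hdom : forall x, (a + t) / 2 <= x <= b -> a < x <= b \/ x = t) by (intros; left; lra).
    repeat (split; [solve [lra | exact Hdom]|]).
    intros s Hs Hst. apply Rabs_def2 in Hst.
    apply (is_RInt_gen_unique (V := C_R_CompleteNormedModule)).
    apply (is_RInt_gen_Chasles (V := C_R_NormedModule) _ t).
    + apply (RInt_gen_correct (V := C_R_CompleteNormedModule)). exact hex.
    + apply (is_RInt_gen_at_point (V := C_R_NormedModule)).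
      apply is_RInt_clamped with (lo := (a + t) / 2) (hi := b); [lra|lra|].
      apply (RInt_correct (V := C_R_CompleteNormedModule)).
      apply (ex_RInt_continuous (V := C_R_CompleteNormedModule)). intros x _.
      now apply continuous_clamped_Vintegrand with (2 := Hdom); [lra|].
  (* Here s >= t already places s in [lo, b], so any positive d would do. *)
  - subst a. exists t, 1.
    assert (Hdom : forall x, t <= x <= b -> t < x <= b \/ x = t).
    { intros x Hx. destruct (Req_dec x t); [now right|left; lra]. }
    repeat (split; [solve [lra | exact Hdom]|]).
    set (g := fun x => Vintegrand alpha f (clamp t b x)).
    assert (Hc : forall x, continuous (U := C_R_NormedModule) g x).
    { intros x. apply continuous_clamped_Vintegrand with (2 := Hdom); [lra|exact hf]. }
    assert (Hi : forall u v, is_RInt (V := C_R_NormedModule) g u v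
                 (RInt (V := C_R_CompleteNormedModule) g u v)).
    { intros u v. apply (RInt_correct (V := C_R_CompleteNormedModule)).
      apply (ex_RInt_continuous (V := C_R_CompleteNormedModule)). intros x _. apply Hc. }
    set (G := fun x => RInt (V := C_R_CompleteNormedModule) g t x).
    assert (HGt : G t = zero) by apply (RInt_point (V := C_R_CompleteNormedModule)).
    (* The primitive G of the clamped integrand is continuous at t with G t = 0, so the improper
       integral is the proper one. *)
    assert (Hgen : forall s, t <= s <= b ->
      RInt_gen (V := C_R_CompleteNormedModule) (Vintegrand alpha f) (at_right t) (at_point s) = G s).
    { intros s Hs. apply (is_RInt_gen_unique (V := C_R_CompleteNormedModule)).
      apply (is_RInt_gen_ext (V := C_R_NormedModule)) with (f := g).
      - apply Filter_prod with (Q := fun x => t < x < b) (R := fun x => x = s).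
        + assert (Hbt : 0 < b - t) by lra. exists (mkposreal _ Hbt). intros y Hy Hty.
          change (Rabs (y - t) < b - t) in Hy. apply Rabs_def2 in Hy. lra.
        + reflexivity.
        + intros x y Hx -> z Hz. simpl in Hz. unfold g. rewrite clamp_id; [reflexivity|].
          assert (t <= Rmin x s) by (apply Rmin_glb; lra).
          assert (Rmax x s <= b) by (apply Rmax_lub; lra). lra.
      - replace (G s) with (minus (G s) (G t)).
        2:{ rewrite HGt. apply (minus_zero_r (G := C_R_NormedModule)). }
        apply (is_RInt_gen_primitive (V := C_R_NormedModule) g G).
        + apply filter_filter.
        + apply filter_filter.
        + exists (mkposreal 1 Rlt_0_1). intros y _ Hy. lra.
        + unfold at_point. lra.
        + intros u v _ _. now apply (is_RInt_primitive_minus (V := C_R_CompleteNormedModule) g t u v).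
        + refine (filterlim_filter_le_1 (F := locally t) G _ _).
          * apply filter_le_within.
          * change (continuous (U := C_R_NormedModule) G t).
            apply (ex_derive_continuous (K := R_AbsRing) (V := C_R_NormedModule)).
            exists (g t). apply (is_derive_RInt (V := C_R_NormedModule)) with (a := t).
            -- apply filter_forall. intros y. apply Hi.
            -- apply Hc.
        + intros P HP. now apply locally_singleton in HP. }
    intros s Hs _. rewrite (Hgen s Hs), (Hgen t) by lra. rewrite HGt.
    unfold G. symmetry. apply (plus_zero_l (G := C_R_NormedModule)).
Qed.

(** * The derivative of the integral *)

Lemma Cminus_0_r (x : C) : (x - 0)%C = x.
Proof. ring. Qed.

Lemma locally_0_Cmod (P : C -> Prop) :
  locally (RtoC 0 : C_UniformSpace) P <-> exists d, 0 < d /\ forall e, Cmod e < d -> P e.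
Proof.
  split.
  - intros [eps H]. exists eps. split; [apply cond_pos|]. intros e He. apply H.
    apply C_NormedModule_mixin_compat1.
    change (minus e (RtoC 0)) with (e - 0)%C. now rewrite Cminus_0_r.
  - intros [d [Hd H]]. assert (Hs : 0 < sqrt 2) by (apply sqrt_lt_R0; lra).
    exists (mkposreal _ (Rdiv_lt_0_compat _ _ Hd Hs)). intros e He. apply H.
    apply C_NormedModule_mixin_compat2 in He.
    change (minus e (RtoC 0)) with (e - 0)%C in He. simpl in He.
    replace (sqrt 2 * (d / sqrt 2)) with d in He by (field; lra).
    now rewrite Cminus_0_r in He.
Qed.

Lemma Cinv_neq_0 (z : C) : z <> 0 -> (/ z)%C <> 0.
Proof. intros Hz H0. apply C1_nz. rewrite <- (Cinv_r z Hz), H0. ring. Qed.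

Lemma poch_neq_0 (z : C) (s : R) : 0 < Re z -> 0 <= s -> poch z s <> 0.
Proof.
  intros Hz Hs. unfold poch. assert (0 < Re (z + s)%C) by (unfold Re in *; simpl; lra).
  apply Cmult_neq_0; [|apply Cinv_neq_0]; now apply CGamma_neq_0.
Qed.

(** The constant coefficient is t, and [1 <= i] ensures that the linear term, hence a nonzero
    derivative at 0, is present. *)
Lemma Varg_linear_part (i : nat) (gamma beta rho delta : C) (p q alpha t : R) :
  (1 <= i)%nat -> 0 < Re beta -> 0 < Re rho -> 0 < Re delta ->
  exists S, strictly_small S /\ S 0 = 0 /\ forall e,
    Varg i gamma beta rho delta p q alpha t e =
    (RtoC t
     + t * CGamma beta * (poch rho q / poch delta p) * / CGamma (gamma + beta)
         * Rpower t (- alpha) * e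
     + S e)%C.
Proof.
  intros Hi Hb Hr Hd.
  set (d := fun k : nat => (t * CGamma beta * (poch rho (q * INR k) / poch delta (p * INR k))
     * / CGamma (gamma * RtoC (INR k) + beta) * RtoC (Rpower t (- alpha)) ^ k)%C).
  destruct (polynomial_linear_part d (i - 1)) as [S [HS [HS0 H]]].
  exists S. split; [exact HS|]. split; [exact HS0|]. intros e.
  assert (E : Varg i gamma beta rho delta p q alpha t e = sum_n (fun k => d k * e ^ k)%C i).
  { unfold Varg, truncH. clear. set (x := RtoC (Rpower t (- alpha))). induction i as [|n IH].
    - rewrite !sum_O. unfold d. fold x. rewrite Cpow_mult_l. unfold Cdiv. ring.
    - rewrite !sum_Sn, <- IH. change (@plus C_AbelianMonoid) with Cplus. unfold d. fold x.
      rewrite Cpow_mult_l. unfold Cdiv. ring. }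
  rewrite E. replace i with (1 + (i - 1))%nat by lia. rewrite H. clear E H.
  (* The Pochhammer symbols at 0 and the ratio of the two Gamma(beta) equal 1 only because Gamma
     does not vanish. *)
  assert (E0 : d 0%nat = t).
  { unfold d. simpl INR. rewrite !Rmult_0_r. cbn [Cpow]. unfold poch.
    replace (rho + 0)%C with rho by ring. replace (delta + 0)%C with delta by ring.
    replace (gamma * 0 + beta)%C with beta by ring.
    field. repeat split; now apply CGamma_neq_0. }
  assert (E1 : d 1%nat = (t * CGamma beta * (poch rho q / poch delta p) * / CGamma (gamma + beta)
         * Rpower t (- alpha))%C).
  { unfold d. simpl INR. rewrite !Rmult_1_r. cbn [Cpow].
    replace (gamma * 1)%C with gamma by ring. ring. }
  rewrite E0, E1. reflexivity.
Qed.

Lemma derivative_Cmod (G : R -> C) (t : R) (l : C) :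
  is_derive (K := R_AbsRing) (V := C_R_NormedModule) G t l ->
  forall eps, 0 < eps -> exists d, 0 < d /\ forall s, Rabs (s - t) < d ->
    Cmod (G s - G t - RtoC (s - t) * l)%C <= eps * Rabs (s - t).
Proof.
  intros [_ H] eps He.
  destruct (H t (fun P HP => HP) (mkposreal _ He)) as [d Hd].
  exists d. split; [apply cond_pos|]. intros s Hs. specialize (Hd s Hs). simpl in Hd.
  rewrite Cmod_norm.
  replace (G s - G t - RtoC (s - t) * l)%C
    with (minus (minus (G s) (G t)) (scal (minus s t) l) : C_R_NormedModule); [exact Hd|].
  unfold minus, plus, opp, scal; simpl. unfold prod_plus, prod_opp, prod_scal; simpl.
  unfold plus, opp, scal, mult; simpl. unfold mult; simpl.
  destruct (G s), (G t), l. simpl. unfold Cminus, Cplus, Copp, Cmult, RtoC; simpl.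
  f_equal; ring.
Qed.

Theorem theorem11 (i : nat) (gamma beta rho delta : C) (p q : R)
    (a b t alpha : R) (f : R -> C)
    (hi : (1 <= i)%nat)
    (hgamma : 0 < Re gamma) (hbeta : 0 < Re beta)
    (hrho : 0 < Re rho) (hdelta : 0 < Re delta)
    (hp : 0 < p) (hq : 0 < q) (hpq : q <= Re gamma + p)
    (ha : 0 <= a) (hab : a < b) (hat : a <= t) (htb : t <= b) (ht : 0 < t)
    (halpha0 : 0 < alpha) (halpha1 : alpha < 1)
    (hf : continuous_on (fun x : R => a < x <= b \/ x = t) f)
    (hex : ex_Vint alpha a f t) :
  is_Vderive i gamma beta rho delta p q alpha
    (fun s : R => a <= s <= b)
    (fun s : R => Vint gamma beta rho delta p q alpha a f s)
    t (f t).
Proof.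
  destruct (Varg_linear_part i gamma beta rho delta p q alpha t hi hbeta hrho hdelta)
    as [S [HS [HS0 HV]]].
  (* A = t^(1 - alpha)/K, where K is the constant in front of the integral. *)
  set (A := (t * CGamma beta * (poch rho q / poch delta p) * / CGamma (gamma + beta)
         * Rpower t (- alpha))%C) in HV.
  assert (Ngb : CGamma (gamma + beta) <> 0).
  { apply CGamma_neq_0. unfold Re in *; simpl; lra. }
  pose proof (CGamma_neq_0 beta hbeta) as Nb.
  pose proof (poch_neq_0 rho q hrho (Rlt_le _ _ hq)) as Nr.
  pose proof (poch_neq_0 delta p hdelta (Rlt_le _ _ hp)) as Nd.
  assert (Nt : RtoC t <> 0) by (intros E; injection E; lra).
  assert (Npow : RtoC (Rpower t (- alpha)) <> 0).
  { intros E; injection E. apply Rgt_not_eq, exp_pos. }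
  assert (NA : A <> 0).
  { unfold A, Cdiv.
    exact (Cmult_neq_0 _ _ (Cmult_neq_0 _ _ (Cmult_neq_0 _ _ (Cmult_neq_0 _ _ Nt Nb)
      (Cmult_neq_0 _ _ Nr (Cinv_neq_0 _ Nd))) (Cinv_neq_0 _ Ngb)) Npow). }
  pose proof (proj1 (Cmod_gt_0 A) NA) as PA.
  set (V := Varg i gamma beta rho delta p q alpha t) in HV.
  set (D := fun s : R => a <= s <= b).
  set (F := within (Vadm i gamma beta rho delta p q alpha D t) (locally (RtoC 0 : C_UniformSpace))).
  assert (FF : Filter F) by (apply within_filter, locally_filter).
  assert (HF : forall P : C -> Prop,
    (exists d, 0 < d /\ forall e, Cmod e < d -> e <> 0 -> Im (V e) = 0 -> D (Re (V e)) -> P e) ->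
    F P).
  { intros P [d [Hd H]]. apply locally_0_Cmod. exists d. split; [exact Hd|].
    intros e He [H1 [H2 H3]]. now apply H. }
  assert (Vreal : forall e, Im (V e) = 0 -> V e = RtoC (Re (V e))).
  { intros e He. destruct (V e) as [u v]. simpl in *. now rewrite He. }
  split.
  - split; [|exact FF]. intros P HP. apply locally_0_Cmod in HP. destruct HP as [d [Hd HP]].
    destruct (local_inverse A S NA HS HS0 d Hd) as [om [Hom Hinv]].
    (* A small real displacement staying in [a, b]: to the right if t < b, otherwise to the left,
       where a < b leaves room. *)
    assert (Hw : exists w, w <> 0 /\ Rabs w < om /\ a <= t + w <= b).
    { destruct (Rlt_le_dec t b) as [L|L].
      - exists (Rmin (om / 2) (b - t)).
        assert (0 < Rmin (om / 2) (b - t)) by (apply Rmin_glb_lt; lra).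
        pose proof (Rmin_l (om / 2) (b - t)). pose proof (Rmin_r (om / 2) (b - t)).
        rewrite Rabs_pos_eq by lra. repeat split; lra.
      - exists (- Rmin (om / 2) (t - a)).
        assert (0 < Rmin (om / 2) (t - a)) by (apply Rmin_glb_lt; lra).
        pose proof (Rmin_l (om / 2) (t - a)). pose proof (Rmin_r (om / 2) (t - a)).
        rewrite Rabs_Ropp, Rabs_pos_eq by lra. repeat split; lra. }
    destruct Hw as [w [Hw0 [Hwom Hwab]]].
    destruct (Hinv (RtoC w)) as [e [He HeV]]; [now rewrite Cmod_R|].
    exists e. apply HP; [exact He|].
    assert (EV : V e = RtoC (t + w)).
    { rewrite HV, <- Cplus_assoc, HeV. now rewrite RtoC_plus. }
    split; [|fold V; rewrite EV; split; [reflexivity | exact Hwab]].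
    (* The increment is nonzero because [V 0] is t while [V e] is t + w. *)
    intros ->. apply Hw0. rewrite HS0 in HeV.
    replace (A * 0 + 0)%C with (RtoC 0) in HeV by ring. now injection HeV.
  (* The remainder satisfies S e = o(e), so the displacement of the evaluation point has derivative
     A at 0. *)
  - assert (LV : Clim F (fun e => (V e - t) / e)%C A).
    { intros eps He. destruct (HS (eps / 2) ltac:(lra)) as [d [Hd H]].
      apply HF. exists d. split; [exact Hd|]. intros e Hed He0 _ _.
      rewrite HV. replace ((t + A * e + S e - t) / e - A)%C with (S e / e)%C by (field; exact He0).
      rewrite Cmod_div by exact He0. pose proof (proj1 (Cmod_gt_0 e) He0) as Pe.
      specialize (H e 0 Hed ltac:(rewrite Cmod_0; lra)). rewrite HS0 in H.
      rewrite !Cminus_0_r in H.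
      apply Rle_lt_trans with (eps / 2); [|lra]. now apply Rle_div_l. }
    assert (Hnear : forall r, 0 < r -> exists d, 0 < d /\ forall e, Cmod e < d -> Im (V e) = 0 ->
      Rabs (Re (V e) - t) < r).
    { intros r Hr. destruct (HS 1 Rlt_0_1) as [d [Hd H]].
      exists (Rmin d (r / (Cmod A + 1))). split.
      { apply Rmin_glb_lt; [exact Hd | apply Rdiv_lt_0_compat; lra]. }
      intros e He Hre. pose proof (Rmin_l d (r / (Cmod A + 1))).
      pose proof (Rmin_r d (r / (Cmod A + 1))).
      rewrite <- Cmod_R, RtoC_minus, <- (Vreal e Hre), HV.
      replace (t + A * e + S e - t)%C with (A * e + S e)%C by ring.
      eapply Rle_lt_trans; [apply Cmod_triangle|]. rewrite Cmod_mult.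
      specialize (H e 0 ltac:(lra) ltac:(rewrite Cmod_0; lra)). rewrite HS0 in H.
      rewrite !Cminus_0_r in H.
      assert (Cmod e * (Cmod A + 1) < r); [|lra].
      apply (Rlt_div_r (Cmod e) r (Cmod A + 1)); lra. }
    destruct (Vint_increment a b t alpha f ha hab hat htb ht hf hex)
      as [lo [d0 [Hlo [Hd0 [Hlot [Hdom Hinc]]]]]].
    set (g := fun x => Vintegrand alpha f (clamp lo b x)) in Hinc.
    set (G := fun s => RInt (V := C_R_CompleteNormedModule) g t s).
    assert (Hg : forall x, continuous (U := C_R_NormedModule) g x).
    { intros x. now apply continuous_clamped_Vintegrand with (2 := Hdom). }
    assert (HGt : G t = RtoC 0) by apply (RInt_point (V := C_R_CompleteNormedModule)).
    assert (HG : is_derive (K := R_AbsRing) (V := C_R_NormedModule) G t (g t)).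
    { apply (is_derive_RInt (V := C_R_NormedModule)) with (a := t); [|apply Hg].
      apply filter_forall. intros s. apply (RInt_correct (V := C_R_CompleteNormedModule)).
      apply (ex_RInt_continuous (V := C_R_CompleteNormedModule)). intros x _. apply Hg. }
    (* The difference quotient of G, completed at t by the derivative. The chain rule then needs no
       division by [V e - t], even if a nonzero increment gives V e = t. *)
    set (phi := fun s => if Req_dec_T s t then g t else (G s / RtoC (s - t))%C).
    assert (Lphi : Clim F (fun e => phi (Re (V e))) (g t)).
    { intros eps He. destruct (derivative_Cmod G t (g t) HG (eps / 2) ltac:(lra)) as [r [Hr H]].
      destruct (Hnear r Hr) as [d [Hd Hn]].
      apply HF. exists d. split; [exact Hd|]. intros e Hed _ Hre _.
      specialize (Hn e Hed Hre). set (s := Re (V e)) in *.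
      specialize (H s Hn). rewrite HGt in H. unfold phi.
      destruct (Req_dec_T s t) as [E|E].
      - replace (g t - g t)%C with (RtoC 0) by ring. now rewrite Cmod_0.
      - assert (Hst : RtoC (s - t) <> 0) by (intros E'; injection E'; lra).
        replace (G s / RtoC (s - t) - g t)%C
          with ((G s - 0 - RtoC (s - t) * g t) / RtoC (s - t))%C by (field; exact Hst).
        rewrite Cmod_div, Cmod_R by exact Hst.
        apply Rle_lt_trans with (eps / 2); [|lra]. apply Rle_div_l; [|exact H].
        apply Rabs_pos_lt. lra. }
    set (K := (CGamma (gamma + beta) * poch delta p / (CGamma beta * poch rho q))%C).
    assert (Hlim : Clim F (fun e => K * (phi (Re (V e)) * ((V e - t) / e)))%C (K * (g t * A))%C).
    { apply Clim_mult; [exact FF | now apply Clim_const | now apply Clim_mult]. }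
    (* K f(t)/t^(1 - alpha) times t^(1 - alpha)/K; the clamp is the identity at t. *)
    assert (Hval : (K * (g t * A))%C = f t).
    { unfold g. rewrite clamp_id by lra. unfold Vintegrand, K, A.
      assert (Ep : Rpower t (1 - alpha) = t * Rpower t (- alpha)).
      { unfold Rminus. rewrite Rpower_plus, Rpower_1 by exact ht. reflexivity. }
      rewrite Ep, RtoC_mult. field. repeat split; assumption. }
    rewrite Hval in Hlim.
    apply filterlim_Clim; [exact FF|]. intros eps He.
    destruct (Hnear d0 Hd0) as [d [Hd Hn]].
    assert (Heq : F (fun e => Vquot i gamma beta rho delta p q alpha
        (fun s => Vint gamma beta rho delta p q alpha a f s) t e =
        (K * (phi (Re (V e)) * ((V e - t) / e)))%C)).
    { apply HF. exists d. split; [exact Hd|]. intros e Hed He0 Hre HD.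
      specialize (Hn e Hed Hre). unfold Vquot. fold V.
      (* The third occurrence is the complex point in the last quotient; admissibility makes it the
         real number s. *)
      rewrite (Vreal e Hre) at 3. set (s := Re (V e)) in *.
      unfold Vint. fold K. rewrite (Hinc s HD Hn). fold (G s).
      set (I0 := RInt_gen _ _ _).
      replace (K * (I0 + G s) - K * I0)%C with (K * G s)%C by ring.
      (* This factorization also holds at s = t, since G t = 0. *)
      replace (G s) with (phi s * (s - t))%C; [field; exact He0|].
      unfold phi. destruct (Req_dec_T s t) as [E|E].
      - rewrite E, HGt. ring.
      - rewrite RtoC_minus. field. rewrite <- RtoC_minus. intros E'; injection E'; lra. }
    generalize (filter_and _ _ Heq (Hlim eps He)). apply filter_imp.
    intros e [-> H]. exact H.
Qed.
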